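(* Let $I=(\mathcal{A},\mathcal{O},W)$ be an add-MARA instance. Every CEEI allocation of $I$ is sequenceable.
   Context: An add-MARA instance is a triple $I=(\mathcal{A},\mathcal{O},W)$ where $\mathcal{A}=\{1,\dots,N\}$ is a nonempty finite set of agents, $\mathcal{O}=\{1,\dots,M\}$ is a nonempty finite set of objects, and $W:\mathcal{A}\times\mathcal{O}\to\mathbb{R}_{\ge 0}$ gives the weight $W(i,\ell)$ of object $\ell$ for agent $i$. The utility of agent $i$ for a share $S\subseteq\mathcal{O}$ is $u_i(S)=\sum_{\ell\in S}W(i,\ell)$. An allocation is a vector $\pi=\langle\pi_1,\dots,\pi_N\rangle$ of pairwise disjoint (possibly empty) subsets of $\mathcal{O}$ with $\bigcup_i\pi_i=\mathcal{O}$. For a price vector $p\in[0,1]^M$, the pair $(\pi,p)$ forms a competitive equilibrium from equal incomes (CEEI) if for every agent $i$, $\pi_i\in\operatorname{argmax}_{S\subseteq\mathcal{O}}\{u_i(S):\sum_{\ell\in S}p_\ell\le 1\}$ (in particular $\sum_{\ell\in\pi_i}p_\ell\le 1$). A CEEI allocation is an allocation $\pi$ for which there exists $p\in[0,1]^M$ such that $(\pi,p)$ forms a CEEI. For $O\subseteq\mathcal{O}$ and an agent $i$, $\mathrm{best}(O,i)=\operatorname{argmax}_{\ell\in O}W(i,\ell)\subseteq O$ is the set of all objects of $O$ of maximal weight for $i$. A sequence of sincere choices is a vector $\sigma=(\sigma_1,\dots,\sigma_M)\in\mathcal{A}^M$. The sequence $\sigma$ generates $\pi$ if there are objects $o_1,\dots,o_M$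 such that, with $\mathcal{O}_1=\mathcal{O}$ and $\mathcal{O}_{t+1}=\mathcal{O}_t\setminus\{o_t\}$, one has $o_t\in\mathrm{best}(\mathcal{O}_t,\sigma_t)$ for $t=1,\dots,M$, and $\pi_i=\{o_t:\sigma_t=i\}$ for every agent $i$. An allocation is sequenceable if some sequence of sincere choices generates it. *)

(* Defs.v *)
From mathcomp Require Import all_boot all_order all_algebra.
From mathcomp Require Import reals.

Set Implicit Arguments.
Unset Strict Implicit.
Unset Printing Implicit Defensive.

Import Order.TTheory GRing.Theory Num.Theory.
Local Open Scope ring_scope.

(* In an add-MARA instance the agents are 'I_N, the objects are 'I_M, and
   W : 'I_N -> 'I_M -> R is the weight function. *)

Definition argmax (R : realType) (T : finType) (f : T -> R) (D : {set T}) :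
    {set T} :=
  [set x in D | [forall y in D, f y <= f x]].

Definition utility (R : realType) (N M : nat) (W : 'I_N -> 'I_M -> R)
    (i : 'I_N) (S : {set 'I_M}) : R :=
  \sum_(l in S) W i l.

(* Disjointness is imposed on distinct agents only, so shares may be empty:
   an allocation need not be a partition in the sense of finset. *)
Definition is_allocation (N M : nat) (pi : 'I_N -> {set 'I_M}) : Prop :=
  (forall i j : 'I_N, i != j -> [disjoint pi i & pi j]) /\
  \bigcup_(i < N) pi i = [set: 'I_M].

Definition affordable (R : realType) (M : nat) (p : 'I_M -> R) :
    {set {set 'I_M}} :=
  [set S : {set 'I_M} | \sum_(l in S) p l <= 1].

Definition forms_CEEI (R : realType) (N M : nat) (W : 'I_N -> 'I_M -> R)
    (pi : 'I_N -> {set 'I_M}) (p : 'I_M -> R) : Prop :=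
  forall i : 'I_N, pi i \in argmax (utility W i) (affordable p).

Definition CEEI_allocation (R : realType) (N M : nat)
    (W : 'I_N -> 'I_M -> R) (pi : 'I_N -> {set 'I_M}) : Prop :=
  is_allocation pi /\
  exists p : 'I_M -> R,
    (forall l : 'I_M, 0 <= p l <= 1) /\ forms_CEEI W pi p.

Definition best (R : realType) (N M : nat) (W : 'I_N -> 'I_M -> R)
    (O : {set 'I_M}) (i : 'I_N) : {set 'I_M} :=
  argmax (W i) O.

(* Time is indexed from 0: picks happen at t = 0, ..., M - 1, and rem t is the
   set of objects still available just before pick t. *)
Definition generates (R : realType) (N M : nat) (W : 'I_N -> 'I_M -> R)
    (sigma : M.-tuple 'I_N) (pi : 'I_N -> {set 'I_M}) : Prop :=
  exists (o : 'I_M -> 'I_M) (rem : nat -> {set 'I_M}),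
    [/\ rem 0%N = [set: 'I_M],
        forall t : 'I_M, rem t.+1 = rem t :\ o t,
        forall t : 'I_M, o t \in best W (rem t) (tnth sigma t)
      & forall i : 'I_N, pi i = [set o t | t : 'I_M & tnth sigma t == i]].

Definition sequenceable (R : realType) (N M : nat) (W : 'I_N -> 'I_M -> R)
    (pi : 'I_N -> {set 'I_M}) : Prop :=
  is_allocation pi /\ exists sigma : M.-tuple 'I_N, generates W sigma pi.

(* Main.v *)
Require Import Defs.
From mathcomp Require Import all_boot all_order all_algebra.
From mathcomp Require Import reals.

(** Whatever nonempty set [O] of objects remains, some agent can sincerely pick
    an object of her own share. Indeed, let [o] be a most expensive object of
    [O], owned by [i], and let [b] be a best object of [O] for [i]. If [b] is
    not already in the share of [i], then exchanging [o] for [b] keeps the share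
    affordable, so by optimality [b] is not strictly better than [o], and [o] is
    itself a best object. Greedily picking such objects exhausts all objects
    and hence yields the required sequence. *)

Set Implicit Arguments.
Unset Strict Implicit.

Import Order.TTheory GRing.Theory Num.Theory.
Local Open Scope ring_scope.

Lemma argmaxP (R : realType) (T : finType) (f : T -> R) (D : {set T}) (x : T) :
  reflect (x \in D /\ forall y, y \in D -> f y <= f x) (x \in argmax f D).
Proof.
rewrite inE; apply: (iffP andP) => -[xD fx]; split=> //.
  by move=> y yD; move/forall_inP: fx => /(_ y yD).
exact/forall_inP.
Qed.

Lemma argmax_neq0 (R : realType) (T : finType) (f : T -> R) (D : {set T}) :
  D != set0 -> exists x, x \in argmax f D.
Proof.
case/set0Pn=> x0 x0D.
case: (Order.TotalTheory.arg_maxP f x0D) => x xD fx.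
by exists x; apply/argmaxP.
Qed.

Lemma sum_exchange (R : realType) (T : finType) (f : T -> R) (S : {set T})
    (a b : T) : a \in S -> b \notin S ->
  \sum_(l in b |: S :\ a) f l = \sum_(l in S) f l - f a + f b.
Proof.
move=> aS bS; rewrite big_setU1 ?inE ?(negPf bS) ?andbF //=.
by rewrite (big_setD1 a aS) /= addrC [f a + _]addrC addrK.
Qed.

Lemma CEEI_exchange (R : realType) (N M : nat) (W : 'I_N -> 'I_M -> R)
    (pi : 'I_N -> {set 'I_M}) (p : 'I_M -> R) (i : 'I_N) (a b : 'I_M) :
  forms_CEEI W pi p -> a \in pi i -> b \notin pi i -> p b <= p a ->
  W i b <= W i a.
Proof.
move=> /(_ i)/argmaxP[afford opt] api bpi pba.
have : b |: pi i :\ a \in affordable p.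
  move: afford; rewrite !inE sum_exchange //; apply: le_trans.
  by rewrite -addrA gerDl addrC subr_le0.
move/opt; rewrite /utility sum_exchange //.
by rewrite -addrA gerDl addrC subr_le0.
Qed.

Lemma CEEI_sincere_pick (R : realType) (N M : nat) (W : 'I_N -> 'I_M -> R)
    (pi : 'I_N -> {set 'I_M}) (p : 'I_M -> R) (O : {set 'I_M}) :
  is_allocation pi -> forms_CEEI W pi p -> O != set0 ->
  exists i o, o \in pi i /\ o \in best W O i.
Proof.
move=> [_ cov] ceei O0.
have [o /argmaxP[oO pmax]] := argmax_neq0 p O0.
have /bigcupP[i _ oi] : o \in \bigcup_(i < N) pi i by rewrite cov inE.
have [b bbest] := argmax_neq0 (W i) O0.
exists i; have [bi|bi] := boolP (b \in pi i); first by exists b.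
exists o; split=> //; have /argmaxP[bO Wmax] := bbest.
apply/argmaxP; split=> // y /Wmax /le_trans; apply.
exact: CEEI_exchange ceei oi bi (pmax b bO).
Qed.

(** The price-free half: each pick comes from the picker's own share and [M] picks exhaust the
    objects, so everyone ends up with exactly her share. *)
Lemma sequenceable_greedy (R : realType) (N M : nat) (W : 'I_N -> 'I_M -> R)
    (pi : 'I_N -> {set 'I_M}) :
  (0 < M)%N -> is_allocation pi ->
  (forall O : {set 'I_M}, O != set0 ->
    exists i o, o \in pi i /\ o \in best W O i) ->
  sequenceable W pi.
Proof.
move=> hM alloc pick; split=> //; have [disj _] := alloc.
have T0 : [set: 'I_M] != set0 by apply/set0Pn; exists (Ordinal hM).
(* A default pair: the choice function [f] must be total, hence also take a value at [set0], where
   its specification is vacuous. *)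
have [i0 [o0 _]] := pick _ T0.
have /fin_all_exists[f fP] : forall O : {set 'I_M}, exists u : 'I_N * 'I_M,
    O != set0 -> u.2 \in pi u.1 /\ u.2 \in best W O u.1.
  move=> O; have [->|O0] := eqVneq O set0; first by exists (i0, o0).
  by have [i [o h]] := pick _ O0; exists (i, o).
pose rem t := iter t (fun O => O :\ (f O).2) [set: 'I_M].
have card_rem t : (t <= M)%N -> #|rem t| = (M - t)%N.
  elim: t => [|t IH] tM; first by rewrite cardsT card_ord subn0.
  have rt := IH (ltnW tM).
  (* As [t < M], objects remain, so the chosen one really lies in [rem t] and its removal lowers the
     cardinality by exactly one. *)
  have /fP[_ /argmaxP[ft _]] : rem t != set0 by rewrite -card_gt0 rt subn_gt0.
  by move: rt; rewrite (cardsD1 (f (rem t)).2) ft subnS => <-.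
have remP (t : 'I_M) : (f (rem t)).2 \in pi (f (rem t)).1 /\
    (f (rem t)).2 \in best W (rem t) (f (rem t)).1.
  by apply: fP; rewrite -card_gt0 card_rem ?subn_gt0 // ltnW.
have picked l t : (t <= M)%N -> l \notin rem t ->
    exists s : 'I_M, l = (f (rem s)).2.
  elim: t => [|t IH] tM; first by rewrite inE.
  have [->|lt] := eqVneq l (f (rem t)).2; first by exists (Ordinal tM).
  by rewrite /= !inE lt; apply: IH; apply: ltnW.
exists [tuple (f (rem t)).1 | t < M].
exists (fun t : 'I_M => (f (rem t)).2), rem; split=> //.
  by move=> t; rewrite tnth_mktuple; have [] := remP t.
move=> i; apply/setP=> l; apply/idP/imsetP => [li|[t]]; last first.
  by rewrite inE tnth_mktuple => /eqP <- ->; have [] := remP t.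
(* [rem M] is empty, so [l] was picked at some time [t]. *)
have [|t lE] := picked l M (leqnn M).
  have /eqP := card_rem M (leqnn M).
  by rewrite subnn cards_eq0 => /eqP->; rewrite inE.
(* The picker at time [t] owns [l], as does [i]; disjointness of the shares forces them to
   coincide. *)
exists t => //; rewrite inE tnth_mktuple; apply/negPn/negP=> /disj.
by move/disjoint_setI0/setP/(_ l); rewrite !inE li {1}lE; have [->] := remP t.
Qed.

Theorem proposition9 (R : realType) (N M : nat) (hN : (0 < N)%N)
    (hM : (0 < M)%N) (W : 'I_N -> 'I_M -> R)
    (W_ge0 : forall (i : 'I_N) (l : 'I_M), 0 <= W i l)
    (pi : 'I_N -> {set 'I_M}) :
  CEEI_allocation W pi -> sequenceable W pi.
Proof.
move=> [alloc [p [_ ceei]]]; apply: sequenceable_greedy => // O.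
exact: CEEI_sincere_pick ceei.
Qed.
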